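(* If $G$ is a cyclic group of order $p^n$, where $p$ is a prime and $n\geq 1$, then \[ R(\mathcal{B}(G))=1+\sqrt{p^2-1}\left(\frac{p^n-1}{p-1}\right), \] \[ \mathrm{ABC}(\mathcal{B}(G))=\sqrt{p^2-1}\left(\sqrt{p^2-2}+p\sqrt{p^4-p^2-1}+p^2\sqrt{p^6-p^4-1}+\ldots+p^{n-1}\sqrt{p^{2n}-p^{2n-2}-1}\right), \] \[ \mathrm{GA}(\mathcal{B}(G))=1+\sqrt{(p^2-1)^3}\left(\frac{2}{p^2}+\frac{2p^3}{p^4-p^2+1}+\frac{2p^6}{p^6-p^4+1}+\ldots+\frac{2p^{3n-3}}{p^{2n}-p^{2n-2}+1}\right), \] \[ H(\mathcal{B}(G))=1+(p^2-1)\left(\frac{2}{p^2}+\frac{2p^2}{p^4-p^2+1}+\frac{2p^4}{p^6-p^4+1}+\ldots+\frac{2p^{2n-2}}{p^{2n}-p^{2n-2}+1}\right) \] and \[ \mathrm{SCI}(\mathcal{B}(G))=\frac{1}{\sqrt{2}}+(p^2-1)\left(\frac{1}{p}+\frac{p^2}{\sqrt{p^4-p^2+1}}+\frac{p^4}{\sqrt{p^6-p^4+1}}+\ldots+\frac{p^{2n-2}}{\sqrt{p^{2n}-p^{2n-2}+1}}\right), \] where each parenthesized sum with dots has $n$ terms, the $k$-th term ($1\le k\le n$) being respectively $p^{k-1}\sqrt{p^{2k}-p^{2k-2}-1}$, $\frac{2p^{3k-3}}{p^{2k}-p^{2k-2}+1}$, $\frac{2p^{2k-2}}{p^{2k}-p^{2k-2}+1}$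 and $\frac{p^{2k-2}}{\sqrt{p^{2k}-p^{2k-2}+1}}$.
   Context: For a finite group $G$, $L(G)$ denotes the set of all subgroups of $G$. The subgroup generating bipartite graph $\mathcal{B}(G)$ is the simple undirected bipartite graph whose vertex set is the disjoint union $(G\times G)\sqcup L(G)$, where $(a,b)\in G\times G$ and $H\in L(G)$ are adjacent if and only if $H=\langle a,b\rangle$ (the subgroup generated by $a$ and $b$); there are no other edges. For a finite simple graph $\mathcal{G}$ with edge set $e(\mathcal{G})$, writing $d(u)$ for the degree of $u$ in $\mathcal{G}$: the Randic Connectivity index is $R(\mathcal{G})=\sum_{uv\in e(\mathcal{G})}(d(u)d(v))^{-1/2}$; the Atom-Bond Connectivity index is $\mathrm{ABC}(\mathcal{G})=\sum_{uv\in e(\mathcal{G})}\left(\frac{d(u)+d(v)-2}{d(u)d(v)}\right)^{1/2}$; the Geometric-Arithmetic index is $\mathrm{GA}(\mathcal{G})=\sum_{uv\in e(\mathcal{G})}\frac{\sqrt{d(u)d(v)}}{\frac12(d(u)+d(v))}$; the Harmonic index is $H(\mathcal{G})=\sum_{uv\in e(\mathcal{G})}\frac{2}{d(u)+d(v)}$; the Sum-Connectivity index is $\mathrm{SCI}(\mathcal{G})=\sum_{uv\in e(\mathcal{G})}(d(u)+d(v))^{-1/2}$. *)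

(* Defs.v *)
From HB Require Import structures.
From mathcomp Require Import all_boot all_order all_algebra.
From mathcomp Require Import all_fingroup all_solvable.
Set Implicit Arguments.
Unset Strict Implicit.
Unset Printing Implicit Defensive.
Import Order.TTheory GRing.Theory Num.Theory.
Local Open Scope ring_scope.

Record simple_graph := SimpleGraph {
  vertex :> finType;
  adj : rel vertex;
  adj_sym : symmetric adj;
  adj_irrefl : irreflexive adj
}.

Section Graph.
Variable Gr : simple_graph.

Definition edges : {set {set Gr}} :=
  [set [set u; v] | u in Gr, v in adj u].

Definition degree (u : Gr) : nat := #|[set v | adj u v]|.

(* An edge is the two-element set e = {u, v}, with u != v, so that
   edge_deg_prod e is d(u)d(v) and edge_deg_sum e is d(u) + d(v). *)
Definition edge_deg_prod (e : {set Gr}) : nat := (\prod_(u in e) degree u)%N.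
Definition edge_deg_sum (e : {set Gr}) : nat := (\sum_(u in e) degree u)%N.

Variable R : rcfType.

Definition Randic : R :=
  \sum_(e in edges) (Num.sqrt (edge_deg_prod e)%:R)^-1.

Definition ABC : R :=
  \sum_(e in edges)
     Num.sqrt (((edge_deg_sum e)%:R - 2) / (edge_deg_prod e)%:R).

Definition GA : R :=
  \sum_(e in edges)
     Num.sqrt (edge_deg_prod e)%:R / (2^-1 * (edge_deg_sum e)%:R).

Definition Harmonic : R :=
  \sum_(e in edges) 2 / (edge_deg_sum e)%:R.

Definition SCI : R :=
  \sum_(e in edges) (Num.sqrt (edge_deg_sum e)%:R)^-1.

End Graph.

Section SubgroupGeneratingBipartiteGraph.
Variables (gT : finGroupType) (G : {group gT}).

Definition sgb_vertex : finType :=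
  (([subg G] * [subg G]) + {H : {group gT} | H \subset G})%type.

Definition sgb_adj : rel sgb_vertex := fun u v =>
  match u, v with
  | inl ab, inr H | inr H, inl ab =>
      <<[set sgval ab.1; sgval ab.2]>>%g == val H :> {set gT}
  | _, _ => false
  end.

Lemma sgb_adj_sym : symmetric sgb_adj.
Proof. by move=> [ab|H] [cd|K]. Qed.

Lemma sgb_adj_irrefl : irreflexive sgb_adj.
Proof. by move=> [ab|H]. Qed.

Definition sgb_graph : simple_graph := SimpleGraph sgb_adj_sym sgb_adj_irrefl.

End SubgroupGeneratingBipartiteGraph.

(* Main.v *)
Require Import Defs.
From mathcomp Require Import all_boot all_order all_algebra.
From mathcomp Require Import all_fingroup all_solvable.
From mathcomp Require Import ring.
Set Implicit Arguments.
Unset Strict Implicit.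
Unset Printing Implicit Defensive.
Import Order.TTheory GRing.Theory Num.Theory.
Local Open Scope ring_scope.
(** All five indices have the shape [\sum_e F (d(u) d(v)) (d(u) + d(v))], so
    they are computed together, for an arbitrary F.

    In B(G) a pair (a, b) has exactly one neighbour, the subgroup <a, b>, while
    a subgroup H has as neighbours the D(H) pairs that generate it.  Hence the
    edges correspond to the pairs, the edge of (a, b) has degree product D(H)
    and degree sum D(H) + 1 for H = <a, b>, and grouping the edges by H turns
    the index into [\sum_H D(H) F(D(H), D(H) + 1)] for any finite group G
    ([sum_edges]).

    When G is cyclic of order p^n, it has exactly one subgroup H_k of order p^k
    for each k <= n, and these form a chain.  A pair of elements of H_k fails
    to generate H_k exactly when both elements lie in H_(k-1), so
    D(H_k) = p^(2k) - p^(2k-2) for k > 0, while D(H_0) = 1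
    ([card_generating_pairs_cyclic_pgroup]).  The formulas follow from
    sqrt(D(H_k)) = sqrt(p^2 - 1) p^(k-1), with a geometric sum for the Randic
    index; the isolated summands 1, 0, 1, 1 and 1/sqrt 2 are the contributions
    of the edge between (1, 1) and the trivial subgroup. *)

(** * Edges as generating pairs *)

(** The elements range over the whole ambient group rather than G, so that the
    count depends on H alone and can be made inside H. *)
Definition generating_pairs (gT : finGroupType) (H : {set gT}) : {set gT * gT} :=
  [set ab | <<[set ab.1; ab.2]>>%g == H].

Lemma card_generating_pairs_subg (gT : finGroupType) (G H : {group gT}) :
    H \subset G ->
  #|[set ab : [subg G] * [subg G] |
      <<[set sgval ab.1; sgval ab.2]>>%g == H :> {set gT}]| = #|generating_pairs H|.
Proof.
move=> sHG; pose f (ab : [subg G] * [subg G]) := (sgval ab.1, sgval ab.2).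
have f_inj : injective f.
  by move=> [a b] [c d] [/val_inj -> /val_inj ->].
rewrite -(card_imset _ f_inj); congr #|pred_of_set _|; apply/setP=> -[a b].
rewrite inE; apply/imsetP/idP => [[ab + ->]|/= /eqP genH]; first by rewrite inE.
have [aH bH] : a \in H /\ b \in H.
  by rewrite -genH !mem_gen // !inE eqxx ?orbT.
exists (subg G a, subg G b).
  by rewrite inE /= !subgK ?(subsetP sHG) ?genH.
by rewrite /f /= !subgK ?(subsetP sHG).
Qed.

Section SumOverEdges.
Variables (gT : finGroupType) (G : {group gT}).
Local Notation B := (sgb_graph G).

Lemma gen_pair_sub (ab : [subg G] * [subg G]) :
  <<[set sgval ab.1; sgval ab.2]>>%G \subset G.
Proof. by rewrite gen_subG subUset !sub1set !subgP. Qed.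

Definition span_vertex (ab : [subg G] * [subg G]) : B :=
  inr (exist _ <<[set sgval ab.1; sgval ab.2]>>%G (gen_pair_sub ab)).

Lemma adj_span_vertex (ab : [subg G] * [subg G]) (v : B) :
  adj (inl ab : B) v = (v == span_vertex ab).
Proof.
case: v => [cd|H] //=; rewrite /sgb_adj /= -[RHS]val_eqE /=.
by rewrite eq_sym.
Qed.

Lemma degree_pair (ab : [subg G] * [subg G]) : degree (inl ab : B) = 1%N.
Proof.
rewrite /degree (_ : [set v | _] = [set span_vertex ab]) ?cards1 //.
by apply/setP=> v; rewrite 2!inE adj_span_vertex.
Qed.

Lemma degree_subgroup (H : {H : {group gT} | H \subset G}) :
  degree (inr H : B) = #|generating_pairs (val H)|.
Proof.
have inl_injB : injective (fun ab : [subg G] * [subg G] => inl ab : B).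
  by move=> ab cd [].
rewrite -(card_generating_pairs_subg (valP H)) /degree -(card_imset _ inl_injB).
apply: eq_card => -[ab|K]; rewrite inE /=.
  by rewrite (mem_imset _ _ inl_injB) inE.
by apply/esym/negP=> /imsetP[].
Qed.

Definition pair_edge (ab : [subg G] * [subg G]) : {set B} :=
  [set inl ab; span_vertex ab].

Lemma pair_edge_inj : injective pair_edge.
Proof.
move=> ab cd eq_e; have: (inl ab : B) \in pair_edge cd.
  by rewrite -eq_e set21.
by rewrite !inE orbF => /eqP[].
Qed.

(** Every edge has a pair as one of its ends, and that pair determines it. *)
Lemma edges_pair_edge : edges B = [set pair_edge ab | ab : [subg G] * [subg G]].
Proof.
apply/setP=> e; apply/imset2P/imsetP=> [[u v _ uv ->]|[ab _ ->]].
  have {uv}: adj u v by [].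
  case: u v => [ab|H] [cd|K] //.
    by rewrite adj_span_vertex => /eqP->; exists ab.
  rewrite adj_sym adj_span_vertex => /eqP->; exists cd => //.
  by rewrite setUC.
exists (inl ab) (span_vertex ab) => //.
by rewrite -[_ \in _]/(adj (inl ab : B) _) adj_span_vertex.
Qed.

(** Grouping the edges by their subgroup end H gives D(H) equal summands for
    each H, where D(H) is the number of pairs generating H. *)
Lemma sum_edges (M : nmodType) (F : nat -> nat -> M) :
  \sum_(e in edges B) F (edge_deg_prod e) (edge_deg_sum e) =
  \sum_(H : {group gT} | H \subset G)
     F #|generating_pairs H| #|generating_pairs H|.+1 *+ #|generating_pairs H|.
Proof.
rewrite edges_pair_edge big_imset => [|ab cd _ _]; last exact: pair_edge_inj.
rewrite /= (partition_big
  (fun ab : [subg G] * [subg G] => <<[set sgval ab.1; sgval ab.2]>>%G)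
  (fun H : {group gT} => H \subset G)) => [|ab _]; last exact: gen_pair_sub.
apply: eq_bigr => H sHG.
rewrite -{3}(card_generating_pairs_subg sHG) -sumr_const.
apply: eq_big => [ab|ab /= /eqP <-]; first by rewrite inE.
have neq_uv : (inl ab : B) \notin [set span_vertex ab] by rewrite inE.
rewrite /edge_deg_prod /edge_deg_sum /pair_edge !big_setU1 //= !big_set1.
by rewrite degree_pair degree_subgroup mul1n add1n.
Qed.
End SumOverEdges.

(** * Generating pairs in cyclic p-groups *)

Lemma cyclic_unique_subgroup (gT : finGroupType) (G : {group gT}) m :
    cyclic G -> (m %| #|G|)%N ->
  exists K : {group gT},
    forall H : {group gT}, (H \subset G) && (#|H| == m) = (H == K).
Proof.
case/cyclicP=> x ->; rewrite -orderE => /cycle_sub_group/setP subG.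
by exists <[x ^+ (#[x]%g %/ m)%N]>%G => H; rewrite -in_set1 -subG inE.
Qed.

(** The subgroup M of order p^k contains every proper subgroup of H, since in a
    cyclic group inclusion of subgroups is divisibility of orders.  So the
    pairs that do not generate H are those of M x M. *)
Lemma card_generating_pairs_cyclic_pgroup (gT : finGroupType) (H : {group gT}) p k :
    prime p -> cyclic H -> #|H| = (p ^ k.+1)%N ->
  #|generating_pairs H| = (p ^ (2 * k.+1) - p ^ (2 * k))%N.
Proof.
move=> p_pr cycH oH.
have [|M subM] := cyclic_unique_subgroup (m := (p ^ k)%N) cycH.
  by rewrite oH dvdn_exp2l.
have /andP[sMH /eqP oM] : (M \subset H) && (#|M| == p ^ k)%N by rewrite subM.
have -> : generating_pairs H = setX H H :\: setX M M.
  apply/setP=> -[a b]; rewrite !inE /= -!sub1set -!subUset.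
  rewrite -[in RHS]gen_subG -[X in _ && X]gen_subG.
  have [sKH|nsKH] := boolP (<<[set a; b]>>%g \subset H); last first.
    by rewrite andbF; apply: contraNF nsKH => /eqP->.
  rewrite andbT eqEcard sKH -(cardSg_cyclic cycH) //.
  (* Both sides now only compare the order p^j of <a, b> with p^k and p^k.+1. *)
  have [j le_jk ->] : exists2 j, (j <= k.+1)%N & #|<<[set a; b]>>%g| = (p ^ j)%N.
    by apply/(dvdn_pfactor _ _ p_pr); rewrite -oH cardSg.
  have p_gt1 := prime_gt1 p_pr.
  by rewrite oH oM leq_exp2l // dvdn_Pexp2l // -ltnNge.
have sMM : setX M M \subset setX H H by rewrite setXS.
by rewrite cardsD (setIidPr sMM) !cardsX oH oM -!expnD !mulSn !mul0n !addn0.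
Qed.

Lemma generating_pairs1 (gT : finGroupType) : generating_pairs [set 1 : gT]%g = [set (1, 1)]%g.
Proof.
apply/setP=> -[a b]; rewrite !inE /= -[[set 1%g]]/(1%g : {set gT}).
by rewrite -subG1 gen_subG subUset !sub1set !inE.
Qed.

(** The order is a bijection from the subgroups of G to the powers p^k with
    k <= n, so a sum over subgroups is a sum over exponents. *)
Lemma sum_subgroups_cyclic_pgroup (M : nmodType) (gT : finGroupType)
    (G : {group gT}) p n (f : {group gT} -> M) (g : nat -> M) :
    prime p -> cyclic G -> #|G| = (p ^ n)%N ->
    (forall (H : {group gT}) k, H \subset G -> #|H| = (p ^ k)%N -> f H = g k) ->
  \sum_(H : {group gT} | H \subset G) f H = \sum_(0 <= k < n.+1) g k.
Proof.
move=> p_pr cycG oG fE; have p_gt1 := prime_gt1 p_pr.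
have subG_card (H : {group gT}) :
    H \subset G -> exists2 j, (j <= n)%N & #|H| = (p ^ j)%N.
  by move=> sHG; apply/(dvdn_pfactor _ _ p_pr); rewrite -oG cardSg.
rewrite big_mkord (partition_big (fun H : {group gT} =>
  inord (logn p #|H|) : 'I_n.+1) xpredT) //=.
apply: eq_bigr => k _.
have [|K subK] := cyclic_unique_subgroup (m := (p ^ k)%N) cycG.
  by rewrite oG dvdn_exp2l // -ltnS.
have /andP[sKG /eqP oK] : (K \subset G) && (#|K| == p ^ k)%N by rewrite subK.
rewrite (big_pred1 K) ?(fE _ k) // => H /=.
rewrite -subK.
have [sHG|//] := boolP (H \subset G); have [j le_jn oH] := subG_card _ sHG.
by rewrite oH pfactorK // eqn_exp2l // -val_eqE /= inordK.
Qed.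

(** * The topological indices *)

(** The trivial subgroup is set apart because its count is 1, whereas the
    formula D k would give 0 at k = 0. *)
Lemma sum_edges_cyclic_pgroup (M : nmodType) (gT : finGroupType)
    (G : {group gT}) p n (F : nat -> nat -> M) :
    prime p -> cyclic G -> #|G| = (p ^ n)%N ->
  let D k := (p ^ (2 * k) - p ^ (2 * k - 2))%N in
  \sum_(e in edges (sgb_graph G)) F (edge_deg_prod e) (edge_deg_sum e) =
  F 1%N 2 + \sum_(1 <= k < n.+1) F (D k) (D k).+1 *+ D k.
Proof.
move=> p_pr cycG oG D; rewrite sum_edges.
pose d k := if k is 0 then 1%N else D k.
rewrite (sum_subgroups_cyclic_pgroup (g := fun k => F (d k) (d k).+1 *+ d k)
  p_pr cycG oG) => [|H [|k] sHG oH].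
- by rewrite big_ltn //; congr (_ + _); apply: eq_big_nat => -[].
- have -> : #|generating_pairs H| = 1%N; last by [].
  by rewrite (card1_trivg oH) generating_pairs1 cards1.
rewrite (card_generating_pairs_cyclic_pgroup p_pr (cyclicS sHG cycG) oH).
by rewrite /= /D mulnS addKn.
Qed.

Theorem theorem4p3 (R : rcfType) (gT : finGroupType) (G : {group gT})
    (p n : nat) (p_prime : prime p) (n_ge1 : (1 <= n)%N)
    (cycG : cyclic G) (cardG : #|G| = (p ^ n)%N) :
  let B := sgb_graph G in
  let q : R := p%:R in
  [/\ Randic B R = 1 + Num.sqrt (q ^+ 2 - 1) * ((q ^+ n - 1) / (q - 1)),
      ABC B R = Num.sqrt (q ^+ 2 - 1) *
        \sum_(1 <= k < n.+1)
          q ^+ (k - 1) * Num.sqrt (q ^+ (2 * k) - q ^+ (2 * k - 2) - 1),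
      GA B R = 1 + Num.sqrt ((q ^+ 2 - 1) ^+ 3) *
        \sum_(1 <= k < n.+1)
          (2 * q ^+ (3 * k - 3)) / (q ^+ (2 * k) - q ^+ (2 * k - 2) + 1),
      Harmonic B R = 1 + (q ^+ 2 - 1) *
        \sum_(1 <= k < n.+1)
          (2 * q ^+ (2 * k - 2)) / (q ^+ (2 * k) - q ^+ (2 * k - 2) + 1)
    & SCI B R = 1 / Num.sqrt 2 + (q ^+ 2 - 1) *
        \sum_(1 <= k < n.+1)
          q ^+ (2 * k - 2) / Num.sqrt (q ^+ (2 * k) - q ^+ (2 * k - 2) + 1)].
Proof.
move=> B q; set s := Num.sqrt (q ^+ 2 - 1).
have q_gt1 : 1 < q by rewrite ltr1n prime_gt1.
have q_ge0 : 0 <= q by rewrite ler0n.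
have q2_gt0 : 0 < q ^+ 2 - 1 by rewrite subr_gt0 exprn_egt1.
have s2 : s ^+ 2 = q ^+ 2 - 1 by rewrite sqr_sqrtr ?ltW.
(* t k is the square root of the number D k of pairs generating H_k. *)
pose t k : R := s * q ^+ (k - 1).
have t_gt0 k : 0 < t k.
  by rewrite mulr_gt0 ?exprn_gt0 ?(lt_trans ltr01 q_gt1) // sqrtr_gt0.
pose D k := (p ^ (2 * k) - p ^ (2 * k - 2))%N.
have DE k : (D k)%:R = q ^+ (2 * k) - q ^+ (2 * k - 2).
  by rewrite natrB ?natrX // leq_exp2l ?prime_gt1 // leq_subr.
have D_fact k : (0 < k)%N -> (D k)%:R = (q ^+ 2 - 1) * q ^+ (2 * k - 2).
  by case: k => // k _; rewrite DE mulnS addKn exprD mulrBl mul1r.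
have Dt k : (0 < k)%N -> (D k)%:R = t k ^+ 2.
  by move=> k_gt0; rewrite D_fact // /t exprMn s2 -exprM mulnBl !(mulnC 2).
have neq_D1 k : (D k)%:R + 1 != 0 :> R by rewrite natr1 pnatr_eq0.
have sqrtD k : (0 < k)%N -> Num.sqrt (D k)%:R = t k.
  by move=> k_gt0; rewrite Dt // sqrtr_sqr gtr0_norm.
split.
- rewrite /Randic (sum_edges_cyclic_pgroup (fun d _ => (Num.sqrt d%:R)^-1)
    p_prime cycG cardG) sqrtr1 invr1; congr (_ + _).
  transitivity (\sum_(1 <= k < n.+1) t k).
    apply: eq_big_nat => k /andP[k_gt0 _].
    rewrite sqrtD // -[LHS]mulr_natl Dt // expr2 mulfK ?gt_eqF //.
  rewrite -mulr_sumr big_add1; congr (_ * _).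
  have q1 : q - 1 != 0 by rewrite subr_eq0 gt_eqF.
  apply: (canRL (mulfK q1)); rewrite mulrC subrX1 big_mkord; congr (_ * _).
  by apply: eq_bigr => i _; rewrite subn1.
- rewrite /ABC (sum_edges_cyclic_pgroup
    (fun d m => Num.sqrt ((m%:R - 2) / d%:R)) p_prime cycG cardG).
  rewrite subrr mul0r sqrtr0 add0r mulr_sumr; apply: eq_big_nat => k /andP[k_gt0 _].
  rewrite mulrA -[s * _]/(t k) -DE -/(D k) -[LHS]mulr_natr -[(D k).+1%:R]natr1.
  have -> : (D k)%:R + 1 - 2 = (D k)%:R - 1 :> R.
    by rewrite -addrA; congr (_ + _); rewrite -[2]/(1 + 1) opprD addrA subrr add0r.
  rewrite sqrtrM ?sqrtrV ?ler0n //; last first.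
    rewrite subr_ge0 ler1n -(ltr0n R) Dt //; exact: exprn_gt0.
  by rewrite sqrtD // {2}Dt // expr2 mulrA mulfVK ?gt_eqF // mulrC.
- rewrite /GA (sum_edges_cyclic_pgroup
    (fun d m => Num.sqrt d%:R / (2^-1 * m%:R)) p_prime cycG cardG).
  rewrite sqrtr1 mulVf ?pnatr_eq0 // divr1; congr (_ + _).
  have -> : Num.sqrt ((q ^+ 2 - 1) ^+ 3) = s ^+ 3.
    by rewrite -s2 -exprM mulnC exprM sqrtr_sqr ger0_norm // exprn_ge0 // sqrtr_ge0.
  rewrite mulr_sumr; apply: eq_big_nat => k /andP[k_gt0 _].
  rewrite -DE -/(D k) sqrtD // -[(D k).+1%:R]natr1 -[LHS]mulr_natr Dt //.
  rewrite -(mulnBr 3 k 1) [(3 * _)%N]mulnC exprM.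
  have := neq_D1 k; rewrite Dt // /t; move: (q ^+ (k - 1)) => x.
  by move: (s) => y D1_neq0; field.
- rewrite /Harmonic (sum_edges_cyclic_pgroup
    (fun _ m => 2 / m%:R) p_prime cycG cardG).
  rewrite divff ?pnatr_eq0 //; congr (_ + _).
  rewrite mulr_sumr; apply: eq_big_nat => k /andP[k_gt0 _].
  rewrite -DE -/(D k) -[LHS]mulr_natr -[(D k).+1%:R]natr1 mulrAC mulrA mulrCA.
  by rewrite -D_fact.
rewrite /SCI (sum_edges_cyclic_pgroup
  (fun _ m => (Num.sqrt m%:R)^-1) p_prime cycG cardG).
rewrite div1r; congr (_ + _).
rewrite mulr_sumr; apply: eq_big_nat => k /andP[k_gt0 _].
by rewrite -DE -/(D k) -[LHS]mulr_natl -[(D k).+1%:R]natr1 mulrA -D_fact.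
Qed.
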